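(* Let $R$ be a ring, let $M$ be a projective right $R$-module, and let $E=\operatorname{End}_R(M)$. If $N$ is a maximal submodule of $M$, then $A:=\operatorname{Hom}_R(M,N)$ is a maximal right ideal of $E$. Moreover, the function $N\longmapsto \operatorname{Hom}_R(M,N)$ is a one-to-one function from $\operatorname{Max}(M)$ into $\operatorname{Max}_r(E)$. In other words, $|\operatorname{Max}(M)|\leq |\operatorname{Max}_r(E)|$.
   Context: Rings are unital with $1\neq 0$; modules are right unital modules; endomorphisms act on the left. $\operatorname{Max}(M)$ is the set of maximal submodules of $M$ and $\operatorname{Max}_r(E)$ is the set of maximal right ideals of $E$. For a submodule $N$ of $M$, $\operatorname{Hom}_R(M,N)$ is identified with the right ideal $\{\beta\in E\mid\beta(M)\subseteq N\}$ of $E$. *)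

(* Defs.v *)
From HB Require Import structures.
From mathcomp Require Import all_boot all_algebra.
From mathcomp Require Import boolp classical_sets functions cardinality.

Set Implicit Arguments.
Unset Strict Implicit.
Unset Printing Implicit Defensive.

Import GRing.Theory.
Local Open Scope classical_set_scope.
Local Open Scope ring_scope.

(* A right R-module is a left module over the converse ring R^c: the element  *)
(* x r is r *: x with r : R^c, and s *: (r *: x) = (r * s : R) *: x, that is  *)
(* (x r) s = x (r s).                                                         *)
Notation rmodType R := (lmodType R^c).

Definition projective (R : nzRingType) (P : rmodType R) : Prop :=
  forall (A B : rmodType R) (g : {linear A -> B}) (f : {linear P -> B}),
    set_surj setT setT g ->
    exists h : {linear P -> A}, forall x : P, g (h x) = f x.

Definition endo (R : nzRingType) (M : rmodType R) : Type := {linear M -> M}.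

(* Endomorphisms act on the left: f * g is f \o g.  Only a pzRingType, since  *)
(* M may be the zero module.                                                  *)
Section EndoRing.
Variables (R : nzRingType) (M : rmodType R).
Implicit Types f g h : endo M.

HB.instance Definition _ := gen_eqMixin (endo M).
HB.instance Definition _ := gen_choiceMixin (endo M).

Definition endo_fun f : M -> M := GRing.Linear.sort f.
Coercion endo_fun : endo >-> Funclass.

Lemma endoP f g : f =1 g -> f = g.
Proof.
case: f => f [[f0] [fZ]]; case: g => g [[g0] [gZ]].
rewrite /endo_fun /= => /funext fg; subst g.
by rewrite (Prop_irrelevance f0 g0) (Prop_irrelevance fZ gZ).
Qed.

Definition endo_zero : endo M := \0 : {linear M -> M}.
Definition endo_opp f : endo M := \- (f : {linear M -> M}) : {linear M -> M}.
Definition endo_add f g : endo M :=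
  (f : {linear M -> M}) \+ (g : {linear M -> M}) : {linear M -> M}.
Definition endo_one : endo M := idfun : {linear M -> M}.
Definition endo_mul f g : endo M :=
  (f : {linear M -> M}) \o (g : {linear M -> M}) : {linear M -> M}.

Lemma endo_addA : associative endo_add.
Proof. by move=> f g h; apply: endoP => x; exact: addrA. Qed.

Lemma endo_addC : commutative endo_add.
Proof. by move=> f g; apply: endoP => x; exact: addrC. Qed.

Lemma endo_add0 : left_id endo_zero endo_add.
Proof. by move=> f; apply: endoP => x; exact: add0r. Qed.

Lemma endo_addN : left_inverse endo_zero endo_opp endo_add.
Proof. by move=> f; apply: endoP => x; exact: addNr. Qed.

Lemma endo_mulA : associative endo_mul.
Proof. by move=> f g h; exact: endoP. Qed.

Lemma endo_mul1l : left_id endo_one endo_mul.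
Proof. by move=> f; exact: endoP. Qed.

Lemma endo_mul1r : right_id endo_one endo_mul.
Proof. by move=> f; exact: endoP. Qed.

Lemma endo_mulDl : left_distributive endo_mul endo_add.
Proof. by move=> f g h; exact: endoP. Qed.

Lemma endo_mulDr : right_distributive endo_mul endo_add.
Proof.
by move=> f g h; apply: endoP => x; exact: (raddfD (f : {linear M -> M})).
Qed.

HB.instance Definition _ := GRing.isZmodule.Build (endo M)
  endo_addA endo_addC endo_add0 endo_addN.

HB.instance Definition _ := GRing.Zmodule_isPzRing.Build (endo M)
  endo_mulA endo_mul1l endo_mul1r endo_mulDl endo_mulDr.

End EndoRing.

Definition maximal_proper (T : Type) (P : set (set T)) : set (set T) :=
  [set N | [/\ P N, N <> setT &
    forall K, P K -> N `<=` K -> K <> setT -> K = N]].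

Definition submodule (R : nzRingType) (M : rmodType R) : set (set M) :=
  [set N : set M | submod_closed [in N]].
Arguments submodule {R} M _.

Definition right_ideal (E : pzRingType) : set (set E) :=
  [set I : set E | zmod_closed [in I] /\ forall a b : E, I a -> I (a * b)].
Arguments right_ideal E _ : clear implicits.

Definition Max (R : nzRingType) (M : rmodType R) : set (set M) :=
  maximal_proper (submodule M).
Arguments Max {R} M _.

Definition Max_r (E : pzRingType) : set (set E) :=
  maximal_proper (right_ideal E).
Arguments Max_r E _ : clear implicits.

Definition Hom_into (R : nzRingType) (M : rmodType R) (N : set M) :
    set (endo M) :=
  [set f | range f `<=` N].

(* Main.v *)
(* If N is a maximal submodule and the image of g : A -> M is not contained   *)
(* in N, then A (+) N -> M is onto; projectivity splits it, so that           *)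
(* id_M = g h modulo Hom(M, N) for some h : M -> A.  With A = M and g an      *)
(* endomorphism outside Hom(M, N), this says that g and Hom(M, N) generate    *)
(* the unit right ideal.  With A = N' another maximal submodule, it says that *)
(* id_M lies in Hom(M, N') + Hom(M, N), so that these two are different.      *)
Require Import Defs.
From HB Require Import structures.
From mathcomp Require Import all_boot all_algebra.
From mathcomp Require Import boolp classical_sets functions cardinality.

Set Implicit Arguments.
Unset Strict Implicit.
Unset Printing Implicit Defensive.

Import GRing.Theory.
Local Open Scope classical_set_scope.
Local Open Scope card_scope.

(** Everything rests on one splitting: if [N] is maximal and [g : A -> M] has image outside [N],
    then lifting the identity of [M] along the surjection from the direct sum of [A] and [N] yields
    [h] with [x - g (h x)] always in [N] ([Max_projective_split]). Applied to an endomorphism it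
    gives maximality of [Hom_into N]; applied to the inclusion of another maximal submodule it gives
    injectivity. *)

Section SubmoduleType.
Local Open Scope ring_scope.
Variables (R : nzRingType) (M : rmodType R) (N : set M) (sN : submodule M N).

(* The dead let keys the predicate on the proof sN, so that the closure       *)
(* instance below can be inferred from the predicate alone.                   *)
Definition submod_pred : {pred M} := let _ := sN in [in N].

HB.instance Definition _ :=
  GRing.isSubmodClosed.Build R^c M submod_pred (sN : submod_closed submod_pred).

(** Makes [N] a module in its own right, to serve as a direct summand and as the source of an
    inclusion map. *)
Definition submod_type := {x : M | x \in submod_pred}.

HB.instance Definition _ := SubChoice.on submod_type.
HB.instance Definition _ := [SubChoice_isSubLmodule of submod_type by <:].

End SubmoduleType.

Section Submodule.
Local Open Scope ring_scope.
Variables (R : nzRingType) (M : rmodType R) (N : set M).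
Hypothesis sN : submodule M N.

Lemma submodule0 : N 0.
Proof. by case: sN => /set_mem. Qed.

Lemma submodule_linear a x y : N x -> N y -> N (a *: x + y).
Proof. by case: sN => _ Nlin /mem_set Nx /mem_set Ny; exact/set_mem/Nlin. Qed.

Lemma submoduleD x y : N x -> N y -> N (x + y).
Proof. by move=> Nx Ny; rewrite -[x]scale1r; exact: submodule_linear. Qed.

Lemma submoduleB x y : N x -> N y -> N (x - y).
Proof. by move=> Nx Ny; rewrite addrC -scaleN1r; exact: submodule_linear. Qed.

End Submodule.

Section MaximalSubmodule.
Local Open Scope ring_scope.
Variables (R : nzRingType) (M : rmodType R).
Implicit Types N : set M.

Lemma Max_add_range (A : rmodType R) (g : {linear A -> M}) N :
  Max M N -> ~ range g `<=` N ->
  forall x, exists a, exists2 n, N n & g a + n = x.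
Proof.
move=> [sN _ maxN] gN.
(* [K] is a submodule containing both [N] and the image of [g]; were it proper, maximality would
   give [K = N]. *)
pose K := [set x | exists a, exists2 n, N n & g a + n = x].
suff KT : K = setT by move=> x; have : K x by rewrite KT.
apply: contrapT => KnT; apply: gN => _ [a _ <-].
rewrite -[N](maxN K) //; first by exists a, 0; [exact: submodule0|exact: addr0].
- split; first by apply/mem_set; exists 0, 0; rewrite ?linear0 ?addr0 //;
    exact: submodule0.
  move=> c _ _ /set_mem[b [n Nn <-]] /set_mem[b' [n' Nn' <-]]; apply/mem_set.
  exists (c *: b + b'), (c *: n + n'); first exact: submodule_linear.
  by rewrite linearP scalerDr addrACA.
- by move=> n Nn; exists 0, n; rewrite ?linear0 ?add0r.
Qed.

Hypothesis projM : projective M.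

Lemma Max_projective_split (A : rmodType R) (g : {linear A -> M}) N :
  Max M N -> ~ range g `<=` N ->
  exists h : {linear M -> A}, forall x, N (x - g (h x)).
Proof.
move=> maxN /(Max_add_range maxN) gN; have [sN _ _] := maxN.
pose S : rmodType R := submod_type sN.
pose s : {linear (A * S)%type -> M} :=
  (g \o (fst : {linear (A * S)%type -> A})) \+
  ((val : {linear S -> M}) \o (snd : {linear (A * S)%type -> S})).
have [|h hK] := @projM _ _ s idfun.
  move=> x _; have [a [n Nn <-]] := gN x.
  by exists (a, exist _ n (mem_set Nn)).
exists (fst \o h) => x /=.
rewrite -[X in X - _](hK x) /= addrAC subrr add0r.
exact: set_mem (valP (h x).2).
Qed.

Lemma Hom_into_right_ideal N :
  submodule M N -> right_ideal (endo M) (Hom_into N).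
Proof.
move=> sN; split; last by move=> f g fN _ [x _ <-]; apply: fN; exists (g x).
split; first by apply/mem_set => _ [x _ <-]; exact: submodule0.
move=> f g /set_mem fN /set_mem gN; apply/mem_set => _ [x _ <-].
by apply: (submoduleB sN); [apply: fN|apply: gN]; exists x.
Qed.

Lemma Max_Hom_into N : Max M N -> Max_r (endo M) (Hom_into N).
Proof.
move=> maxN; have [sN NT _] := maxN; split; first exact: Hom_into_right_ideal.
  move=> HT; apply: NT; apply/seteqP; split=> // x _.
  have : Hom_into N (1 : endo M) by rewrite HT.
  by apply; exists x.
move=> K [/GRing.zmod_closedD[_ KD] KM] HK KT; apply/seteqP; split=> // f Kf.
apply: contrapT => fN; apply: KT; apply/seteqP; split=> // g _.
have [h hN] := Max_projective_split maxN fN.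
(* [1 - f * k] maps [M] into [N], hence lies in [K], as does [f]; so the right ideal [K] contains
   both summands. *)
pose k : endo M := h; have -> : g = (1 - f * k) * g + f * (k * g).
  by rewrite mulrBl mul1r mulrA subrK.
apply/set_mem/KD; apply/mem_set; apply: KM => //.
by apply: HK => _ [x _ <-]; exact: hN.
Qed.

Lemma Hom_into_inj : set_inj (Max M) (@Hom_into R M).
Proof.
move=> N N' /set_mem maxN /set_mem maxN' HE; apply: contrapT => NN'.
have [sN _ max] := maxN; have [sN' N'T _] := maxN'.
pose g : {linear submod_type sN -> M} := val.
have gN' : ~ range g `<=` N'.
  move=> gN'; apply: NN'.
  by apply/esym/max => // n Nn; apply: gN'; exists (exist _ n (mem_set Nn)).
have [h hN'] := Max_projective_split maxN' gN'.
(* [g \o h] has values in [N], so the equality of the two ideals puts them in [N'] too; since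
   [x - g (h x)] is in [N'], so is every [x]. *)
have : Hom_into N (g \o h : {linear M -> M}).
  by move=> _ [x _ <-]; exact: set_mem (valP (h x)).
rewrite HE => ghN'; apply: N'T; apply/seteqP; split=> // x _.
by rewrite -(subrK (g (h x)) x); apply: (submoduleD sN') => //;
  apply: ghN'; exists x.
Qed.

End MaximalSubmodule.

Theorem theorem3p5 (R : nzRingType) (M : rmodType R) (projM : projective M) :
  [/\ forall N : set M, Max M N -> Max_r (endo M) (Hom_into N),
      set_inj (Max M) (@Hom_into R M)
    & Max M #<= Max_r (endo M)].
Proof.
split; [exact: Max_Hom_into|exact: Hom_into_inj|].
have /card_eqPle[_ MaxE] := inj_card_eq (Hom_into_inj projM).
apply: card_le_trans MaxE _; apply: subset_card_le => _ [N maxN <-].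
exact: Max_Hom_into.
Qed.
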